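(* Let $n,m$ be positive integers with $m+2\le n$, $G=P^m_n$ and $\mathcal R=\{G_i:i\in [n]\}$ a family of pairwise vertex-disjoint graphs. Then $$\gamma_{gr}(G\hookleftarrow \mathcal R)=\max_{I \in \tilde{\mathcal I}} \left\{\sum_{i\in I} (\gamma_{gr} (G_i)-1)+ M(I)-m(I)-|I|m\right\}+m+1.$$ Moreover, given a Grundy dominating sequence $S_i$ of $G_i$ for all $i\in [n]$ and $I^*\in \tilde{\mathcal I}$ attaining this maximum, the sequence obtained from $S_P(I^* )$ by replacing each $i\in I^*$ by $S_i$ (and each other vertex $j$ of $S_P(I^* )$ by a vertex of $G_j$) is a Grundy dominating sequence of $G\hookleftarrow \mathcal R$.
   Context: $P_n^m$ has vertex set $[n]$, distinct $i,j$ adjacent iff $|i-j|\le m$. For a non-empty set $I\subseteq[n]$, $m(I)=\min I$ and $M(I)=\max I$. $\tilde{\mathcal I}$ is the family of non-empty independent sets $I$ of $P_n^m$ with $m(I)\le m+1$ and $M(I)\ge n-m$. For $I=\{i^1<\dots<i^p\}\in\tilde{\mathcal I}$, let $S_j=(i^j,i^j+1,\dots,i^{j+1}-(m+1))$ for $j\in[p-1]$ and $S_P(I)=S_1\oplus\cdots\oplus S_{p-1}\oplus(i^p)$ (concatenation). The $X$-join product $G\hookleftarrow \mathcal R$ has vertex set $\bigcup_i V(G_i)$, the edges of all $G_i$, and all edges between $V(G_i)$ and $V(G_j)$ whenever $ij\in E(G)$. A legal dominating sequence of a graph is a sequence $(v_1,\dots,v_k)$ of distinct vertices whose set is dominating and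 such that each $N[v_i]\setminus\bigcup_{j<i}N[v_j]$ is non-empty ($N[\cdot]$ the closed neighborhood); a Grundy dominating sequence is one of maximum length, and $\gamma_{gr}$ is that length. *)

(* Defs.v *)
From HB Require Import structures.
From mathcomp Require Import all_boot all_order all_algebra.
Set Implicit Arguments. Unset Strict Implicit. Unset Printing Implicit Defensive.
Import Order.TTheory GRing.Theory Num.Theory.
From mathcomp Require Import ssrint.

(* A finite simple graph is a symmetric irreflexive relation [e] on a finType. *)

Definition cnbh (V : finType) (e : rel V) (v : V) : {set V} :=
  [set u | (u == v) || e v u].

Fixpoint legal_from (V : finType) (e : rel V) (cov : {set V}) (s : seq V) : bool :=
  match s with
  | [::] => true
  | v :: s' => (cnbh e v :\: cov != set0) && legal_from e (cov :|: cnbh e v) s'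
  end.

Definition legal_dom_seq (V : finType) (e : rel V) (s : seq V) : bool :=
  [&& uniq s, legal_from e set0 s &
      \bigcup_(v <- s) cnbh e v == [set: V]].

(* Grundy domination number: maximum length of a legal dominating sequence
   (such sequences have distinct vertices, hence length <= #|V|). *)
Definition gamma_gr (V : finType) (e : rel V) : nat :=
  \max_(k < #|V|.+1 | [exists t : k.-tuple V, legal_dom_seq e t]) k.

Definition grundy_dom_seq (V : finType) (e : rel V) (s : seq V) : Prop :=
  legal_dom_seq e s /\ size s = gamma_gr e.

(* The graph P_n^m on vertex set [n]; vertex i : 'I_n stands for i.+1 in [n]. *)
Definition padj (n m : nat) (i j : 'I_n) : bool :=
  [&& i != j, (i - j <= m)%N & (j - i <= m)%N].

Definition join_rel (n m : nat) (T : 'I_n -> finType) (e : forall i, rel (T i))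
  (x y : {i : 'I_n & T i}) : bool :=
  if tag x == tag y then e (tag x) (tagged x) (tagged_as x y)
  else padj m (tag x) (tag y).

(* m(I) and M(I), in the labels 1..n *)
Definition minI (n : nat) (I : {set 'I_n}) : nat := \big[minn/n]_(i in I) i.+1.
Definition maxI (n : nat) (I : {set 'I_n}) : nat := \max_(i in I) i.+1.

Definition indep (n m : nat) (I : {set 'I_n}) : bool :=
  [forall i in I, forall j in I, ~~ padj m i j].

Definition tildeI (n m : nat) (I : {set 'I_n}) : bool :=
  [&& I != set0, indep m I, (minI I <= m.+1)%N & (n - m <= maxI I)%N].

Definition valI (n m : nat) (T : 'I_n -> finType) (e : forall i, rel (T i))
  (I : {set 'I_n}) : int :=
  (\sum_(i in I) ((gamma_gr (e i))%:Z - 1) + (maxI I)%:Z - (minI I)%:Z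
    - (#|I| * m)%:Z)%R.

(* S_P(I) for a sorted list of labels l = [:: i^1 < ... < i^p]:
   S_j = (i^j, i^j + 1, ..., i^{j+1} - (m+1)), followed by i^p. *)
Fixpoint SPlist (m : nat) (l : seq nat) : seq nat :=
  match l with
  | [::] => [::]
  | [:: a] => [:: a]
  | a :: ((b :: _) as t) => iota a (b - m - a) ++ SPlist m t
  end.

Definition SP (n m : nat) (I : {set 'I_n}) : seq nat :=
  SPlist m (sort leq [seq (nat_of_ord i).+1 | i <- enum I]).

Definition expand_SP (n m : nat) (T : 'I_n -> finType) (I : {set 'I_n})
  (S : forall i, seq (T i)) (c : forall i, T i) : seq {i : 'I_n & T i} :=
  flatten [seq match @insub nat (fun k => k < n)%N _ k.-1 with
               | Some i => if i \in I then [seq Tagged T x | x <- S i]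
                           else [:: Tagged T (c i)]
               | None => [::]
               end | k <- SP m I].

(* Main.v *)
Require Import Defs.
From HB Require Import structures.
From mathcomp Require Import all_boot all_order all_algebra.
Import Order.TTheory GRing.Theory Num.Theory.
From mathcomp Require Import ssrint zify.

(* Lower bound: for any non-empty independent I, expanding S_P(I) gives a legal
   sequence: a block of I is entered undominated, and a single vertex played in
   block k newly dominates block k + m.

   Upper bound: let s be a legal sequence of the join.  Give each of its vertices a
   newly dominated vertex (itself, if it was undominated), let F be the set of
   blocks containing these footprints and I the set of blocks whose first visit
   precedes every visit to an adjacent block.  The footprints in block k come from
   a legal sequence of G_k, and there is at most one of them unless k is in I, so
   |s| <= |F| + sum_(k in I) (gamma_gr (G_k) - 1).  Adding min F and max F to I gives
   an independent set J such that, between consecutive elements of J, the m blocks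
   next to the one visited first contain no footprint; hence |F| <= |S_P(J)|.

   Finally, a non-empty independent set of maximum value lies in the family
   tilde I, since otherwise min - (m+1) or max + (m+1) could be added to it. *)

(** * Legal sequences in an arbitrary graph *)

Section LegalSequences.
#[local] Set Implicit Arguments. #[local] Unset Strict Implicit.
Variables (V : finType) (e : rel V).
Implicit Types (s : seq V) (cov : {set V}).

Definition dominated s : {set V} := \bigcup_(v <- s) cnbh e v.

Lemma in_dominated s u : (u \in dominated s) = has (fun v => u \in cnbh e v) s.
Proof.
rewrite /dominated; elim: s => [|v s IH]; first by rewrite big_nil inE.
by rewrite big_cons in_setU IH.
Qed.

Lemma cnbh_refl v : v \in cnbh e v.
Proof. by rewrite inE eqxx. Qed.

Lemma legal_from_cat cov s1 s2 :
  legal_from e cov (s1 ++ s2) =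
  legal_from e cov s1 && legal_from e (cov :|: dominated s1) s2.
Proof.
rewrite /dominated; elim: s1 cov => [|v s IH] cov /=; first by rewrite big_nil setU0.
by rewrite big_cons IH setUA andbA.
Qed.

Lemma legal_from_notin cov s v :
  legal_from e cov s -> v \in s -> ~~ (cnbh e v \subset cov).
Proof.
elim: s cov => [|x s IH] cov //= /andP[Hx Hs].
rewrite inE => /orP[/eqP->|/(IH _ Hs)]; first by rewrite -setD_eq0.
by apply: contra => H; apply: subset_trans H (subsetUl _ _).
Qed.

Lemma legal_from_uniq cov s : legal_from e cov s -> uniq s.
Proof.
elim: s cov => [|x s IH] cov //= /andP[_ Hs].
rewrite (IH _ Hs) andbT; apply/negP => /(legal_from_notin Hs).
by rewrite subsetUr.
Qed.

(** Any undominated vertex may be appended, since it newly dominates itself; the induction is on the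
    number of undominated vertices. *)
Lemma legal_from_extend cov s : legal_from e cov s ->
  exists r, legal_from e cov (s ++ r) /\ cov :|: dominated (s ++ r) = [set: V].
Proof.
have [k] := ubnP #|~: (cov :|: dominated s)|.
elim: k s => // k IH s Hk Hs.
have [/eqP E|[u]] := set_0Vmem (~: (cov :|: dominated s)).
  exists [::]; rewrite cats0; split=> //.
  by apply/setP=> x; move/eqP/setP/(_ x): E; rewrite !inE => /negbFE.
rewrite inE => Hu.
have Hs' : legal_from e cov (rcons s u).
  rewrite -cats1 legal_from_cat Hs /= andbT.
  by apply/set0Pn; exists u; rewrite inE cnbh_refl andbT.
have sub : dominated (rcons s u) = dominated s :|: cnbh e u.
  by rewrite /dominated -cats1 big_cat big_seq1.
have [|r [Hr1 Hr2]] := IH (rcons s u) _ Hs'; last first.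
  by exists (u :: r); rewrite -cat_rcons.
move: Hk; rewrite ltnS; apply: leq_trans; apply: proper_card.
rewrite sub setUA; apply/properP; split.
  by rewrite setCS subsetUl.
by exists u; rewrite inE // negbK inE cnbh_refl orbT.
Qed.

Lemma legal_dom_size_le s : legal_dom_seq e s -> (size s <= gamma_gr e)%N.
Proof.
move=> H; have /and3P[U _ _] := H.
have Hlt : (size s < #|V|.+1)%N.
  by rewrite ltnS -(card_uniqP U) max_card.
rewrite /gamma_gr (bigD1 (Ordinal Hlt)) /= ?leq_maxl //.
by apply/existsP; exists (in_tuple s).
Qed.

Lemma legal_size_le s : legal_from e set0 s -> (size s <= gamma_gr e)%N.
Proof.
move=> /legal_from_extend[r [Hr D]].
have /legal_dom_size_le : legal_dom_seq e (s ++ r).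
  by rewrite /legal_dom_seq (legal_from_uniq Hr) Hr -[X in X == _]set0U; apply/eqP.
by apply: leq_trans; rewrite size_cat leq_addr.
Qed.

(* A legal sequence of maximum length dominates: otherwise it could be extended. *)
Lemma legal_max_grundy s :
  legal_from e set0 s -> size s = gamma_gr e -> grundy_dom_seq e s.
Proof.
move=> Hs Es; split=> //; have [r [Hr D]] := legal_from_extend Hs.
have := legal_size_le Hr; rewrite size_cat Es -{2}(addn0 (gamma_gr e)) leq_add2l.
rewrite leqn0 size_eq0 => /eqP E; move: D; rewrite {}E cats0 set0U => D.
by rewrite /legal_dom_seq (legal_from_uniq Hs) Hs; apply/eqP.
Qed.

Lemma grundy_exists : exists s, grundy_dom_seq e s.
Proof.
have [r [Hr D]] := legal_from_extend (isT : legal_from e set0 [::]).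
have Hd : legal_dom_seq e r.
  by rewrite /legal_dom_seq (legal_from_uniq Hr) Hr -[X in X == _]set0U; apply/eqP.
have U : uniq r by case/and3P: Hd.
have Hlt : (size r < #|V|.+1)%N by rewrite ltnS -(card_uniqP U) max_card.
pose P (k : 'I_#|V|.+1) := [exists t : k.-tuple V, legal_dom_seq e t].
have HP : (0 < #|P|)%N.
  by apply/card_gt0P; exists (Ordinal Hlt); apply/existsP; exists (in_tuple r).
have [k Hk E] := eq_bigmax_cond (fun k : 'I_#|V|.+1 => k : nat) HP.
have /existsP[t Ht] := Hk; exists t; split=> //.
by rewrite size_tuple /gamma_gr -E.
Qed.

Lemma gamma_gr_gt0 : (0 < #|V|)%N -> (0 < gamma_gr e)%N.
Proof.
move=> /card_gt0P[v _]; apply: (@legal_size_le [:: v]); rewrite /= andbT.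
by apply/set0Pn; exists v; rewrite !inE eqxx.
Qed.

(** Here [u t] is the newly dominated vertex at step [t]. Naming it explicitly lets footprints found
    in the join be carried over to a single factor. *)
Lemma legal_from_map (A : Type) (x u : A -> V) cov (s : seq A) :
  all (fun t => (u t \in cnbh e (x t)) && (u t \notin cov)) s ->
  pairwise (fun t1 t2 => u t2 \notin cnbh e (x t1)) s ->
  legal_from e cov [seq x t | t <- s].
Proof.
elim: s cov => //= t s IH cov /andP[/andP[H1 H2] H3] /andP[H4 H5].
apply/andP; split; first by apply/set0Pn; exists (u t); rewrite inE H1 H2.
apply: IH => //; move: (conj H3 H4) => /andP; rewrite -all_predI.
by apply: sub_all => y /= /andP[/andP[-> /= h1] h2]; rewrite inE negb_or h1.
Qed.

(** The played vertex is preferred as its own footprint. This makes a visit to a block untouched so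
    far leave its footprint in that block. *)
Lemma legal_footprint s (t : 'I_(size s)) : legal_from e set0 s ->
  exists u, [/\ u \in cnbh e (tnth (in_tuple s) t),
    forall r : 'I_(size s), (r < t)%N -> u \notin cnbh e (tnth (in_tuple s) r) &
    (forall r : 'I_(size s), (r < t)%N ->
       tnth (in_tuple s) t \notin cnbh e (tnth (in_tuple s) r)) ->
    u = tnth (in_tuple s) t].
Proof.
move=> Hs; set v := tnth _ t.
have nthE (r : 'I_(size s)) : tnth (in_tuple s) r = nth v s r by exact: tnth_nth.
have Hdrop : drop t s = v :: drop t.+1 s by rewrite (drop_nth v) // -nthE.
have domP u : u \notin dominated (take t s) <->
    forall r : 'I_(size s), (r < t)%N -> u \notin cnbh e (tnth (in_tuple s) r).
  rewrite in_dominated; split=> [/hasPn H r Hr|H].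
    apply: H; rewrite nthE -(nth_take v Hr); apply: mem_nth.
    by rewrite size_take; case: ifP => // _; apply: leq_trans Hr (ltnW (ltn_ord t)).
  apply/hasPn => y /(nthP v)[r]; rewrite size_take ltn_ord => Hr.
  rewrite nth_take // => <-.
  by have := H (Ordinal (ltn_trans Hr (ltn_ord t))) Hr; rewrite nthE.
move: Hs; rewrite -{1}(cat_take_drop t s) legal_from_cat Hdrop set0U /=.
move=> /and3P[_ /set0Pn[u]]; rewrite inE => /andP[Hu1 Hu2] _.
have [Hv|Hv] := boolP (v \in dominated (take t s)).
  exists u; split=> //; first exact/domP.
  by move/domP; rewrite Hv.
by exists v; split=> //; [exact: cnbh_refl | exact/domP].
Qed.

End LegalSequences.

(** * Label lists with gaps larger than m, and the length of S_P *)

Section SpacedLists.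
#[local] Set Implicit Arguments. #[local] Unset Strict Implicit.
Variable m : nat.

Lemma sorted_consecutive (R : rel nat) (l : seq nat) : sorted ltn l ->
  (forall a b, a \in l -> b \in l -> (a < b)%N ->
     (forall x, x \in l -> ~~ (a < x < b)%N) -> R a b) ->
  sorted R l.
Proof.
case: l => //= a l; elim: l a => //= b l IH a /andP[Hab Hl] H.
have Hmin : all (fun x => b < x)%N l by exact: order_path_min ltn_trans Hl.
rewrite H ?inE ?eqxx ?orbT //=.
  apply: IH => // c d Hc Hd Hcd Hcons.
  apply: H => //; rewrite ?(in_cons a) ?Hc ?Hd ?orbT //.
  move=> x; rewrite inE => /orP[/eqP->|]; last exact: Hcons.
  have : (b <= c)%N by move: Hc; rewrite inE => /orP[/eqP->|/(allP Hmin)/ltnW].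
  lia.
move=> x; rewrite !inE => /or3P[/eqP->|/eqP->|/(allP Hmin)]; lia.
Qed.

Definition far (a b : nat) := (a + m < b)%N.

Lemma far_path_min a l : path far a l -> all (far a) l.
Proof. by apply: order_path_min => y x z; rewrite /far; lia. Qed.

Lemma far_path_last a l : path far a l -> (a <= last a l)%N.
Proof.
by elim: l a => //= b l IH a /andP[Hab /IH]; move: Hab; rewrite /far; lia.
Qed.

(** The run for a gap from [a] to [b] has length [b - m - a], so adding [m] per gap makes the sum
    telescope. *)
Lemma size_SPlist a l : path far a l ->
  (size (SPlist m (a :: l)) + size l * m + a = (last a l).+1)%N.
Proof.
elim: l a => [|b l IH] a; first by rewrite /= => _; lia.
rewrite [path _ _ _]/= => /andP[Hab /IH E].
rewrite [last _ _]/= -E [SPlist _ _]/= -/(SPlist m (b :: l)) size_cat size_iota.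
by move: Hab; rewrite /far [size (_ :: _)]/=; set q := size (SPlist _ _); lia.
Qed.

Lemma sum_SPlist (f : nat -> nat) a l : path far a l ->
  (forall k, (a <= k)%N -> k \notin a :: l -> f k = 0%N) ->
  (\sum_(k <- SPlist m (a :: l)) f k = \sum_(k <- a :: l) f k)%N.
Proof.
elim: l a => // b l IH a; rewrite [path _ _ _]/= => /andP[Hab Hl] H.
rewrite [SPlist _ _]/= -/(SPlist m (b :: l)) big_cat [RHS]big_cons IH //; last first.
  move=> k Hk Hn; apply: H; first by move: Hab; rewrite /far; lia.
  by rewrite inE negb_or Hn andbT; move: Hab; rewrite /far; lia.
congr addn; have -> : (b - m - a = (b - m - a).-1.+1)%N by move: Hab; rewrite /far; lia.
rewrite /= big_cons big_seq big1 ?addn0 // => k; rewrite mem_iota => Hk.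
apply: H; first by lia.
rewrite !inE !negb_or; apply/and3P; split; try by move: Hab; rewrite /far; lia.
by apply/negP => /(allP (far_path_min Hl)); move: Hab; rewrite /far; lia.
Qed.

Lemma mem_SPlist a l k : path far a l -> k \in SPlist m (a :: l) ->
  (a <= k <= last a l)%N.
Proof.
elim: l a => [|b l IH] a; first by rewrite /= inE => _ /eqP->; rewrite leqnn.
rewrite [path _ _ _]/= => /andP[Hab Hl]; have := far_path_last Hl.
rewrite [SPlist _ _]/= -/(SPlist m (b :: l)) mem_cat mem_iota.
have -> : last a (b :: l) = last b l by [].
by move: Hab; rewrite /far => Hab Hb /orP[|/(IH _ Hl)]; lia.
Qed.

(** The window consists of the labels from [d + 1] to [d + m], all strictly between [a] and [b]. *)
Definition windowed (F : pred nat) (a b : nat) : bool :=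
  has (fun d => (d + m < b)%N && all (fun x => ~~ F x) (iota d.+1 m)) (index_iota a b).

Lemma windowedP (F : pred nat) a b d : (a <= d)%N -> (d + m < b)%N ->
  (forall x, (d < x <= d + m)%N -> ~~ F x) -> windowed F a b.
Proof.
move=> Had Hd H; apply/hasP; exists d; first by rewrite mem_index_iota; lia.
by rewrite Hd; apply/allP => x; rewrite mem_iota => Hx; apply: H; lia.
Qed.

Lemma windowed_far (F : pred nat) a b : windowed F a b -> far a b.
Proof. by case/hasP => d; rewrite mem_index_iota /far; lia. Qed.

Lemma count_windowed (F : pred nat) a b : windowed F a b ->
  (count F (iota a (b - a)) + m <= b - a)%N.
Proof.
case/hasP => d; rewrite mem_index_iota => Hd /andP[Hdb /allP H].
(* The interval splits into the part up to [d], the window, where [F] counts nothing, and the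
   rest. *)
have -> : (b - a = (d.+1 - a) + (m + (b - d.+1 - m)))%N by lia.
rewrite !iotaD !count_cat.
have -> : (a + (d.+1 - a) = d.+1)%N by lia.
have -> : count F (iota d.+1 m) = 0%N.
  by apply/eqP; rewrite -leqn0 leqNgt -has_count; apply/hasPn.
have := count_size F (iota a (d.+1 - a)).
have := count_size F (iota (d.+1 + m) (b - d.+1 - m)).
rewrite !size_iota; lia.
Qed.

Lemma count_path_windowed (F : pred nat) a l : path (windowed F) a l ->
  (count F (iota a ((last a l).+1 - a)) <= size (SPlist m (a :: l)))%N.
Proof.
move=> Hp; have Hfar : path far a l by apply: sub_path Hp => x y; exact: windowed_far.
suff : (count F (iota a ((last a l).+1 - a)) + size l * m + a <= (last a l).+1)%N.
  by rewrite -(size_SPlist Hfar); lia.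
elim: l a Hp Hfar => [|b l IH] a.
  by move=> _ _; have := count_size F (iota a (a.+1 - a)); rewrite size_iota /=; lia.
rewrite /= => /andP[Hab Hp] /andP[Hf Hfar].
have := IH _ Hp Hfar; have := count_windowed Hab; have := far_path_last Hfar.
move: Hf; rewrite /far => Hf Hb H1 H2.
have -> : ((last b l).+1 - a = (b - a) + ((last b l).+1 - b))%N by lia.
rewrite iotaD count_cat; have -> : (a + (b - a) = b)%N by lia.
lia.
Qed.

End SpacedLists.

(** * Sorted labels of a set of blocks, its minimum and maximum *)

Section Labels.
#[local] Set Implicit Arguments. #[local] Unset Strict Implicit.
Variables (n m : nat).
Implicit Type I : {set 'I_n}.

Definition labels I := sort leq [seq (nat_of_ord i).+1 | i <- enum I].

Lemma labels_perm I : perm_eq (labels I) [seq (nat_of_ord i).+1 | i <- enum I].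
Proof. by rewrite perm_sort. Qed.

Lemma labels_sorted I : sorted ltn (labels I).
Proof.
rewrite ltn_sorted_uniq_leq sort_sorted ?andbT; last exact: leq_total.
rewrite sort_uniq map_inj_uniq ?enum_uniq // => i j /= [] E; exact: val_inj.
Qed.

Lemma labelsP I k : reflect (exists2 i, i \in I & k = (nat_of_ord i).+1) (k \in labels I).
Proof.
rewrite (perm_mem (labels_perm I)); apply: (iffP mapP) => -[i Hi ->]; exists i => //.
  by rewrite mem_enum in Hi.
by rewrite mem_enum.
Qed.

Lemma mem_labels I (i : 'I_n) : (i.+1 \in labels I) = (i \in I).
Proof.
apply/labelsP/idP => [[j Hj [] E]|Hi]; last by exists i.
by rewrite (_ : i = j) //; exact: val_inj.
Qed.

Lemma labels_cons I : I != set0 -> exists a l, labels I = a :: l.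
Proof.
case/set0Pn => i; rewrite -mem_labels; case: (labels I) => // a l _; by exists a, l.
Qed.

Lemma size_labels I : size (labels I) = #|I|.
Proof. by rewrite (perm_size (labels_perm I)) size_map cardE. Qed.

Lemma indepP I : reflect (forall i j, i \in I -> j \in I -> (i < j)%N -> (i + m < j)%N)
  (indep m I).
Proof.
apply: (iffP forall_inP) => H.
  move=> i j Hi Hj Hij; have /forall_inP/(_ j Hj) := H i Hi.
  by rewrite /padj -val_eqE /=; lia.
move=> i Hi; apply/forall_inP => j Hj; rewrite /padj -val_eqE /=.
by case: (ltngtP i j) => // Hij; [have := H _ _ Hi Hj Hij | have := H _ _ Hj Hi Hij]; lia.
Qed.

Lemma labels_indep I : indep m I = sorted (far m) (labels I).
Proof.
apply/indepP/idP => [H|].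
  apply: sorted_consecutive (labels_sorted I) _ => a b /labelsP[i Hi ->] /labelsP[j Hj ->].
  by rewrite ltnS => Hij _; rewrite /far; have := H _ _ Hi Hj Hij; lia.
have tr : transitive (far m) by move=> y x z; rewrite /far; lia.
rewrite sorted_pairwise // => Hp i j Hi Hj Hij.
have /(nthP 0)[p Hps Hp1] : i.+1 \in labels I by rewrite mem_labels.
have /(nthP 0)[q Hqs Hq1] : j.+1 \in labels I by rewrite mem_labels.
move/(pairwiseP 0): Hp => Hp.
case: (ltngtP p q) => [Hpq|Hpq|E].
- by have := Hp _ _ Hps Hqs Hpq; rewrite Hp1 Hq1 /far; lia.
- by have := Hp _ _ Hqs Hps Hpq; rewrite Hp1 Hq1 /far; lia.
- by move: Hp1; rewrite E Hq1; lia.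
Qed.

Lemma labels_le I k : k \in labels I -> (0 < k <= n)%N.
Proof. by case/labelsP => i _ ->; rewrite /= ltn_ord. Qed.

Lemma minI_le I i : i \in I -> (minI I <= i.+1)%N.
Proof.
move=> Hi; rewrite /minI; have := mem_index_enum i.
elim: (index_enum _) => //= j s IH; rewrite inE big_cons => /orP[/eqP<-|/IH H].
  by rewrite Hi geq_minl.
by case: ifP => // _; apply: leq_trans H; rewrite geq_minr.
Qed.

(** The bound [k <= n] accounts for [n], the default value of the iterated minimum. *)
Lemma minI_ge I k : (k <= n)%N -> (forall i, i \in I -> (k <= i.+1)%N) -> (k <= minI I)%N.
Proof.
move=> Hk H; rewrite /minI; elim/big_ind: _ => // x y; rewrite leq_min => -> //.
Qed.

Lemma minI_labels I a l : labels I = a :: l -> minI I = a.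
Proof.
move=> E; have Hl : path ltn a l by have := labels_sorted I; rewrite E.
have Ha : a \in labels I by rewrite E inE eqxx.
have /labelsP[i Hi Ei] := Ha.
apply/eqP; rewrite eqn_leq {1}Ei minI_le //=.
apply: minI_ge => [|j]; first by case/andP: (labels_le Ha).
rewrite -mem_labels E inE => /orP[/eqP->//|].
by move/(allP (order_path_min ltn_trans Hl)) => /ltnW.
Qed.

Lemma maxI_labels I a l : labels I = a :: l -> maxI I = last a l.
Proof.
move=> E; have Hl : path ltn a l by have := labels_sorted I; rewrite E.
have -> : maxI I = \max_(k <- labels I) k.
  by rewrite (perm_big _ (labels_perm I)) big_map big_enum.
rewrite E; elim: l a Hl {E} => [|b l IH] a /=; first by rewrite big_seq1.
(* With spacing 0, [far] is the strict order. *)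
by case/andP => Hab Hl; rewrite big_cons IH //; have := far_path_last (m := 0) (a := b) (l := l);
   rewrite (eq_path (e' := ltn)) => [/(_ Hl)|x y]; rewrite /far; lia.
Qed.

Lemma minI_mem I : I != set0 -> exists2 i, i \in I & minI I = i.+1.
Proof.
move=> /labels_cons[a [l E]]; rewrite (minI_labels E); apply/labelsP.
by rewrite E mem_head.
Qed.

Lemma maxI_mem I : I != set0 -> exists2 i, i \in I & maxI I = i.+1.
Proof.
move=> /labels_cons[a [l E]]; rewrite (maxI_labels E); apply/labelsP.
by rewrite E mem_last.
Qed.

Lemma maxI_ge I i : i \in I -> (i.+1 <= maxI I)%N.
Proof. by move=> Hi; rewrite /maxI (bigD1 i) //= leq_maxl. Qed.

End Labels.

(** * Stretches without footprint beside a fresh visit *)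

Section Windows.
#[local] Set Implicit Arguments. #[local] Unset Strict Implicit.
Variables (N m : nat).

(** Equal or adjacent blocks. Positions are integers so that the line can be reflected and fences
    can be placed outside the range of blocks. *)
Definition near (x y : int) : bool := (x - y <= m%:Z)%R && (y - x <= m%:Z)%R.

Definition fresh (w : 'I_N -> int) (t : 'I_N) : bool :=
  [forall s : 'I_N, (s < t)%N ==> ~~ near (w s) (w t)].

(* At time [t] a vertex of block [w t] is played and it newly dominates some
   vertex of block [b t].  A block other than [b t] near [b t] cannot have been
   visited before, since one visit dominates all adjacent blocks. *)
Definition footprinting (w b : 'I_N -> int) : Prop :=
  [/\ forall t, near (w t) (b t),
      forall s t : 'I_N, (s < t)%N -> near (w s) (b t) -> w s = b t &
      forall t, fresh w t -> b t = w t].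

Lemma freshP (w : 'I_N -> int) (t : 'I_N) :
  reflect (forall s : 'I_N, (s < t)%N -> ~~ near (w s) (w t)) (fresh w t).
Proof. by apply: (iffP forallP) => H s; [move/implyP: (H s) | apply/implyP/H]. Qed.

(* No block strictly between [w t0] and the fence [z] is visited before [t0]: the
   first such visit would be fresh, as neither [w t0] nor [z] has been approached.
   So a footprint within [m] after [w t0] could come from nowhere. *)
Lemma right_window w b t0 (z : int) : footprinting w b -> fresh w t0 ->
  (w t0 + m%:Z < z)%R ->
  (forall t : 'I_N, (t < t0)%N -> ~~ near (w t) z) ->
  (forall t : 'I_N, (t < t0)%N -> fresh w t -> ~~ (w t0 < w t < z)%R) ->
  forall t, ~~ (w t0 < b t <= w t0 + m%:Z)%R.
Proof.
move=> [H1 H2 H3] /[dup] Hf /freshP H0 Hz Hnz Hgap.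
have early : forall t : 'I_N, (t < t0)%N -> ~~ (w t0 < w t < z)%R.
  move=> t; have [k] := ubnP (t : nat); elim: k t => // k IH t Htk Ht.
  have [/Hgap|] := boolP (fresh w t); first exact.
  rewrite negb_forall => /existsP[s]; rewrite negb_imply negbK => /andP[Hst Hn].
  have Hs0 : (s < t0)%N by apply: ltn_trans Ht.
  have Hsk : (s < k)%N by apply: leq_trans Hst _.
  have := IH s Hsk Hs0; have := H0 s Hs0; have := Hnz s Hs0.
  by move: Hn; rewrite /near; lia.
move=> t; apply/negP => Hb.
(* Before [t0], visits lie more than [m] left of [w t0] or right of [z], hence too far away. After
   [t0], a footprint near [w t0] must lie in that very block, and so does the footprint at [t0]. *)
case: (ltngtP t t0) => [Ht|Ht|/val_inj E].
- have := early t Ht; have := H0 t Ht; have := Hnz t Ht; have := H1 t.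
  by move: Hb; rewrite /near; lia.
- by have := H2 _ _ Ht; move: Hb; rewrite /near; lia.
- by have := H3 t0 Hf; move: Hb; rewrite E; lia.
Qed.

(** Mirror image of [right_window] under negation of all positions. *)
Lemma left_window w b t0 (z : int) : footprinting w b -> fresh w t0 ->
  (z < w t0 - m%:Z)%R ->
  (forall t : 'I_N, (t < t0)%N -> ~~ near (w t) z) ->
  (forall t : 'I_N, (t < t0)%N -> fresh w t -> ~~ (z < w t < w t0)%R) ->
  forall t, ~~ (w t0 - m%:Z <= b t < w t0)%R.
Proof.
move=> [H1 H2 H3] H0 Hz Hnz Hgap t.
have fN s : fresh (fun t => - w t)%R s = fresh w s.
  by apply/freshP/freshP => Hs r /Hs; rewrite /near; lia.
have := @right_window (fun t => - w t)%R (fun t => - b t)%R t0 (- z)%R.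
have fp : footprinting (fun t => - w t)%R (fun t => - b t)%R.
  split=> [s|r s Hrs|s]; last by rewrite fN => /H3->.
    by have := H1 s; rewrite /near; lia.
  by have := H2 r s Hrs; rewrite /near; lia.
rewrite fN => /(_ fp H0) R; suff : ~~ (- w t0 < - b t <= - w t0 + m%:Z)%R by lia.
apply: R; first by lia.
  by move=> s /Hnz; rewrite /near; lia.
by move=> s Hs; rewrite fN => /(Hgap s Hs); lia.
Qed.

End Windows.

(** * Bounding the number of footprinted blocks *)

Section Packing.
#[local] Set Implicit Arguments. #[local] Unset Strict Implicit.

(* [J] consists of the fresh blocks and the two extreme footprinted ones; by the
   window lemmas, next to one end of each gap of [J] there are [m] consecutive
   blocks without footprint. *)
Lemma footprint_packing (n m N : nat) (w b : 'I_N -> 'I_n) : (0 < N)%N ->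
  footprinting m (fun t => (w t : nat)%:Z)%R (fun t => (b t : nat)%:Z)%R ->
  exists J : {set 'I_n}, [/\ J != set0, indep m J,
    forall t, fresh m (fun t => (w t : nat)%:Z)%R t -> w t \in J,
    J \subset [set b t | t : 'I_N] & (#|[set b t | t : 'I_N]| <= size (SP m J))%N].
Proof.
move=> HN; set wz := fun t => _; set bz := fun t => _ => Hfp.
have [H1 H2 H3] := Hfp.
pose t0 := Ordinal HN.
have f0 : fresh m wz t0 by apply/freshP.
pose F := [set b t | t : 'I_N]; pose I := [set w t | t in fresh m wz].
have bF t : b t \in F by apply/imsetP; exists t.
have FP x : x \in F -> exists t, x = b t by case/imsetP => t _ ->; exists t.
have IP x : x \in I -> exists2 t, fresh m wz t & x = w t by case/imsetP => t Ht ->; exists t.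
have wI t : fresh m wz t -> w t \in I by move=> Ht; apply/imsetP; exists t.
have fE t : fresh m wz t -> b t = w t by move/H3 => [E]; apply: val_inj.
clear H1 H2 H3.
have IF x : x \in I -> x \in F by case/IP => t /fE <- ->.
case: (arg_minnP (fun t => b t : nat) (isT : predT t0)) => tm _ Hmin.
case: (arg_maxnP (fun t => b t : nat) (isT : predT t0)) => tM _ Hmax.
pose J := b tm |: (b tM |: I).
have JI x : x \in J -> x \notin I -> x = b tm \/ x = b tM.
  by rewrite !in_setU1 => /or3P[/eqP|/eqP|->]; auto.
have IJ x : x \in I -> x \in J by move=> Hx; rewrite !in_setU1 Hx !orbT.
have JF x : x \in J -> x \in F by rewrite !in_setU1 => /or3P[/eqP->|/eqP->|/IF].
have J0 : J != set0 by apply/set0Pn; exists (w t0); apply/IJ/wI.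
pose Fl k := k \in labels F.
have Jwin : sorted (windowed m Fl) (labels J).
  apply: sorted_consecutive (labels_sorted J) _ => _ _ /labelsP[i Hi ->] /labelsP[j Hj ->].
  rewrite ltnS => Hij Hcons.
  have {Hcons} Hcons x : x \in I -> ~~ (i < x < j)%N.
    by move=> /IJ Hx; have := Hcons x.+1; rewrite mem_labels => /(_ Hx).
  have lo x : x \in F -> (b tm <= x)%N by move=> /FP[t ->]; exact: Hmin.
  have hi x : x \in F -> (x <= b tM)%N by move=> /FP[t ->]; exact: Hmax.
  have winR : (forall t, ~~ (i < b t <= i + m)%N) -> windowed m Fl i.+1 j.+1.
    move=> Hw; apply: (@windowedP _ _ _ _ i.+1) => //.
      (* Block [j] carries a footprint, so it lies beyond the window and [i + m < j]. *)
      have /FP[t Et] := JF j Hj.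
      by have := Hw t; rewrite -Et; lia.
    move=> x Hx; apply/negP => /labelsP[y /FP[t ->] Ex].
    by have := Hw t; lia.
  have winL : (forall t, ~~ (j - m <= b t < j)%N) -> windowed m Fl i.+1 j.+1.
    move=> Hw; have Him : (i + m < j)%N.
      have /FP[t Et] := JF i Hi.
      by have := Hw t; rewrite -Et; lia.
    (* Labels exceed indices by one: the label [j - m] immediately precedes those of the blocks
       [j - m] to [j - 1]. *)
    apply: (@windowedP _ _ _ _ (j - m)); try by lia.
    move=> x Hx; apply/negP => /labelsP[y /FP[t ->] Ex].
    by have := Hw t; lia.
  have [iI|iI] := boolP (i \in I); have [jI|jI] := boolP (j \in I).
  - have [ti fi Ei] := IP i iI; have [tj fj Ej] := IP j jI.
    (* The end visited first gets the window on its side, and the other end serves as the fence. *)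
    case: (ltngtP ti tj) => [Ht|Ht|/val_inj E]; last by move: Hij; rewrite Ei Ej E ltnn.
    + have Hn := freshP _ _ _ fj _ Ht.
      have R := @right_window _ _ _ _ ti (j : nat)%:Z%R Hfp fi.
      apply: winR => t; suff : ~~ (wz ti < bz t <= wz ti + m%:Z)%R.
        by rewrite /wz /bz Ei; lia.
      apply: R.
      * by move: Hn; rewrite /near /wz -Ei -Ej; lia.
      * by move=> s Hs; have := freshP _ _ _ fj s (ltn_trans Hs Ht); rewrite /wz -Ej.
      * by move=> s Hs /wI/Hcons; rewrite /wz -Ei; lia.
    + have Hn := freshP _ _ _ fi _ Ht.
      have R := @left_window _ _ _ _ tj (i : nat)%:Z%R Hfp fj.
      apply: winL => t; suff : ~~ (wz tj - m%:Z <= bz t < wz tj)%R.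
        by rewrite /wz /bz Ej; lia.
      apply: R.
      * by move: Hn; rewrite /near /wz -Ei -Ej; lia.
      * by move=> s Hs; have := freshP _ _ _ fi s (ltn_trans Hs Ht); rewrite /wz -Ei.
      * by move=> s Hs /wI/Hcons; rewrite /wz -Ej; lia.
  - have jM : j = b tM.
      by case: (JI j Hj jI) => // E; have := lo i (JF i Hi); rewrite -E; lia.
    have [ti fi Ei] := IP i iI.
    apply: winR => t; suff : ~~ (wz ti < bz t <= wz ti + m%:Z)%R.
      by rewrite /wz /bz Ei; lia.
    (* Since [j] is the last footprinted block, the fence can be put out of reach of every block. *)
    apply: (@right_window _ _ _ _ ti (n + m + m)%N%:Z%R Hfp fi).
    + by rewrite /wz; have := ltn_ord (w ti); lia.
    + by move=> s _; rewrite /near /wz; have := ltn_ord (w s); lia.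
    + move=> s Hs Hf; have := Hcons _ (wI s Hf); have := hi _ (IF _ (wI s Hf)).
      have : w s != j by apply: contraNneq jI => <-; exact: wI.
      by rewrite -jM /wz -Ei -val_eqE /=; lia.
  - have im : i = b tm.
      by case: (JI i Hi iI) => // E; have := hi j (JF j Hj); rewrite -E; lia.
    have [tj fj Ej] := IP j jI.
    apply: winL => t; suff : ~~ (wz tj - m%:Z <= bz t < wz tj)%R.
      by rewrite /wz /bz Ej; lia.
    apply: (@left_window _ _ _ _ tj (- (m + m + 1)%N%:Z)%R Hfp fj).
    + by rewrite /wz; lia.
    + by move=> s _; rewrite /near /wz; lia.
    + move=> s Hs Hf; have := Hcons _ (wI s Hf); have := lo _ (IF _ (wI s Hf)).
      have : w s != i by apply: contraNneq iI => <-; exact: wI.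
      by rewrite -im /wz -Ej -val_eqE /=; lia.
  (* Here [i] and [j] would be the two extreme footprinted blocks, yet the first block visited is
     fresh and lies strictly between them. *)
  - have W := wI _ f0; have := Hcons _ W; have := lo _ (IF _ W); have := hi _ (IF _ W).
    have : w t0 != i by apply: contraNneq iI => <-.
    have : w t0 != j by apply: contraNneq jI => <-.
    have := lo j (JF j Hj); have := hi i (JF i Hi).
    rewrite -!val_eqE /=.
    case: (JI i Hi iI) => Ei; case: (JI j Hj jI) => Ej; rewrite -?Ei -?Ej;
      by move: Hij; rewrite Ei Ej; lia.
exists J; split=> //.
- rewrite labels_indep; apply: sub_sorted Jwin => x y; exact: windowed_far.
- by move=> t /wI/IJ.
- by apply/subsetP.
have [a [l E]] := labels_cons J0.
have Hp : path (windowed m Fl) a l by move: Jwin; rewrite E.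
have Hfar : path (far m) a l by apply: sub_path Hp => x y; exact: windowed_far.
(* As [J] contains both extreme footprinted blocks, every label of [F] lies in the interval being
   counted. *)
rewrite /SP -/(labels J) E; apply: leq_trans (count_path_windowed Hp).
rewrite -/F -size_labels -size_filter; apply: uniq_leq_size.
  by have := labels_sorted F; rewrite ltn_sorted_uniq_leq => /andP[].
move=> x Hx; rewrite mem_filter /Fl Hx mem_iota /=.
have inJ k : k \in labels J -> (a <= k <= last a l)%N.
  rewrite E inE => /orP[/eqP->|Hk]; first by rewrite leqnn (far_path_last Hfar).
  have := allP (far_path_min Hfar) k Hk; rewrite /far.
  move: Hk => /splitPr Hs; case: Hs Hfar => p1 p2.
  rewrite cat_path last_cat /= => /and3P[_ _ /far_path_last]; lia.
have /labelsP[y /FP[t ->] ->] := Hx.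
have := inJ (b tm).+1; have := inJ (b tM).+1; have := Hmin t isT; have := Hmax t isT.
rewrite !mem_labels !in_setU1 !eqxx orbT /= => h1 h2 /(_ isT) h3 /(_ isT) h4.
by have := far_path_last Hfar; lia.
Qed.

End Packing.

(** * The join product and the natural-number value of a set of blocks *)

Section Join.
Variables (n m : nat) (T : 'I_n -> finType) (e : forall i, rel (T i)).
Hypothesis Hne : forall i, (0 < #|T i|)%N.
#[local] Set Implicit Arguments. #[local] Unset Strict Implicit.
Local Notation H := (join_rel m e).
Implicit Types (I : {set 'I_n}) (x y : {i : 'I_n & T i}) (cov : {set {i : 'I_n & T i}}).

(** The length of the expanded S_P: one vertex per label, and gamma_gr - 1 more for each block of
    [I]. *)
Definition weight I : nat := (\sum_(i in I) (gamma_gr (e i)).-1 + size (SP m I))%N.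

Lemma weightE I : I != set0 -> indep m I ->
  (weight I + #|I| * m + minI I =
   \sum_(i in I) (gamma_gr (e i)).-1 + maxI I + m.+1)%N.
Proof.
move=> /labels_cons[a [l E]]; rewrite labels_indep E => Hl.
have := size_SPlist Hl; rewrite /weight /SP -/(labels I) E.
rewrite (minI_labels E) (maxI_labels E) -(size_labels I) E.
rewrite [size (_ :: l)]/=; set p := size (SPlist _ _); lia.
Qed.

Lemma valI_weight I : I != set0 -> indep m I ->
  (valI m e I + (m.+1)%:Z = (weight I)%:Z)%R.
Proof.
move=> I0 II; have := weightE I0 II; rewrite /valI.
have -> : (\sum_(i in I) ((gamma_gr (e i))%:Z - 1) =
          (\sum_(i in I) (gamma_gr (e i)).-1)%N%:Z)%R.
  rewrite raddf_sum /=; apply: eq_bigr => i _.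
  by have := gamma_gr_gt0 (e i) (Hne i); lia.
lia.
Qed.

Lemma in_cnbh_same i (u v : T i) :
  (Tagged T u \in cnbh H (Tagged T v)) = (u \in cnbh (e i) v).
Proof. by rewrite !inE /join_rel /= eqxx tagged_asE eq_Tagged. Qed.

Lemma in_cnbh_diff x y : tag x != tag y -> (y \in cnbh H x) = padj m (tag x) (tag y).
Proof.
move=> Hxy; rewrite inE /join_rel (negPf Hxy) orbC; case: eqP => [E|]; last by rewrite orbF.
by rewrite E eqxx in Hxy.
Qed.

Definition block I (S : forall i, seq (T i)) (c : forall i, T i) (k : nat) :
    seq {i : 'I_n & T i} :=
  match @insub nat (fun k => k < n)%N _ k.-1 with
  | Some i => if i \in I then [seq Tagged T u | u <- S i] else [:: Tagged T (c i)]
  | None => [::]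
  end.

(** * Lower bound: expanding S_P is legal *)

Section Expand.
#[local] Unset Implicit Arguments.
Variables (I : {set 'I_n}) (S : forall i, seq (T i)) (c : forall i, T i).
Hypothesis HS : forall i, grundy_dom_seq (e i) (S i).
#[local] Set Implicit Arguments.
Local Notation blk := (block I S c).

Lemma blockE (i : 'I_n) :
  blk i.+1 = if i \in I then [seq Tagged T u | u <- S i] else [:: Tagged T (c i)].
Proof. by rewrite /block [_.-1]/= valK. Qed.

Lemma label_ord k : (0 < k <= n)%N -> exists i : 'I_n, k = i.+1.
Proof. by case: k => // k /= Hk; exists (Ordinal Hk). Qed.

Lemma block_tag k x : (0 < k)%N -> x \in blk k -> (tag x).+1 = k.
Proof.
rewrite /block; case: insubP => // i _ /= E Hk.
case: ifP => _; last by rewrite inE => /eqP-> /=; move: E Hk; clear; case: k => [|k]; lia.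
by case/mapP => u _ -> /=; lia.
Qed.

(** Domination reaches labels up to [b + m], that is, indices below [b + m]. *)
Lemma dominated_blocks (s : seq nat) b y : all (fun k => 0 < k <= b)%N s ->
  y \in dominated H (flatten [seq blk k | k <- s]) -> (tag y < b + m)%N.
Proof.
move=> Hs; rewrite in_dominated => /hasP[x /flatten_mapP[k Hk Hx]].
have /andP[k0 kb] := allP Hs k Hk; move: kb; rewrite -(block_tag k0 Hx) => kb.
have [E|/in_cnbh_diff->] := eqVneq (tag x) (tag y).
  by move=> _; rewrite -E; apply: leq_trans kb (leq_addr _ _).
by rewrite /padj; lia.
Qed.

(** Inside one block the join induces the factor, so newly dominated vertices stay new. The
    induction only tracks the part of [cov] lying in block [i]. *)
Lemma legal_block i cov :
  (forall u : T i, Tagged T u \notin cov) ->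
  legal_from H cov [seq Tagged T u | u <- S i].
Proof.
move=> Hcov; have [/and3P[_ + _] _] := HS i.
have {Hcov} : forall u : T i, Tagged T u \in cov -> u \in set0.
  by move=> u; rewrite (negPf (Hcov u)).
elim: (S i) (set0) cov => //= v s IH cov0 cov Hc /andP[/set0Pn[u Hu] Hs].
apply/andP; split.
  apply/set0Pn; exists (Tagged T u); move: Hu; rewrite !in_setD in_cnbh_same.
  by case/andP => Hu ->; rewrite andbT; apply: contra Hu => /Hc.
apply: IH Hs => w; rewrite !in_setU in_cnbh_same => /orP[/Hc->|->] //.
by rewrite orbT.
Qed.

Lemma size_expand : I != set0 -> indep m I -> size (expand_SP m I S c) = weight I.
Proof.
move=> /labels_cons[a [l E]]; rewrite labels_indep E => Hl.
have -> : expand_SP m I S c = flatten [seq blk k | k <- SPlist m (a :: l)].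
  by rewrite -E.
rewrite /weight /SP -/(labels I) E size_flatten /shape -map_comp sumnE big_map.
have Hlast : (last a l <= n)%N.
  by have /labels_le/andP[] : last a l \in labels I by rewrite E mem_last.
have Ha : (0 < a)%N by have /labels_le/andP[] : a \in labels I by rewrite E mem_head.
pose f k := (size (blk k)).-1.
have fE (i : 'I_n) : f i.+1 = if i \in I then (gamma_gr (e i)).-1 else 0%N.
  by rewrite /f blockE; case: ifP; rewrite ?size_map ?(HS i).2.
transitivity (\sum_(k <- SPlist m (a :: l)) (f k + 1))%N.
  rewrite !big_seq; apply: eq_bigr => k /(mem_SPlist Hl) Hk.
  have [i ->] : exists i : 'I_n, k = i.+1 by apply: label_ord; lia.
  rewrite fE /= blockE; case: ifP => // _.
  by rewrite size_map (HS i).2; have := gamma_gr_gt0 (e i) (Hne i); lia.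
rewrite big_split /= sum1_size; congr addn.
rewrite sum_SPlist //; last first.
  move=> k Hk; rewrite -E => Hkl.
  have [kn|nk] := leqP k n; last by rewrite /f /block insubF //; lia.
  have [i Ek] : exists i : 'I_n, k = i.+1 by apply: label_ord; lia.
  by move: Hkl; rewrite Ek mem_labels fE => /negPf->.
rewrite -E (perm_big _ (labels_perm I)) big_map big_enum /=.
by apply: eq_bigr => i Hi; rewrite fE Hi.
Qed.

Hypothesis Hm : (0 < m)%N.

(** The vertex played at label [a] newly dominates the block labelled [a + m], which [cov] does not
    reach yet. *)
Lemma legal_singles a r cov : (0 < a)%N -> (a + r + m <= n.+1)%N ->
  (forall i, i \in I -> ~~ (a <= i.+1 < a + r)%N) ->
  (forall y, y \in cov -> ((tag y).+1 < a + m)%N) ->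
  legal_from H cov (flatten [seq blk k | k <- iota a r]).
Proof.
elim: r a cov => //= r IH a cov Ha Hn HI Hc.
have [i Ei] : exists i : 'I_n, a = i.+1 by apply: label_ord; lia.
have [j Ej] : exists j : 'I_n, a + m = j.+1 by apply: label_ord; lia.
have Hi : i \notin I by apply/negP => /HI; lia.
rewrite legal_from_cat Ei blockE (negPf Hi) /= andbT -Ei; apply/andP; split.
  have /card_gt0P[u _] := Hne j.
  apply/set0Pn; exists (Tagged T u); rewrite inE in_cnbh_diff /=; last first.
    by rewrite -val_eqE /=; lia.
  rewrite /padj -val_eqE /=; apply/andP; split; last by lia.
  by apply/negP => /Hc /=; lia.
apply: IH; [lia | lia | by move=> k /HI; lia |].
move=> y; rewrite in_setU => /orP[/Hc|Hy]; first by lia.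
have : y \in dominated H (flatten [seq blk k | k <- [:: a]]).
  by rewrite /= Ei blockE (negPf Hi).
by move/(@dominated_blocks [:: a] a); rewrite /= Ha leqnn => /(_ isT); lia.
Qed.

Lemma legal_SPlist a l cov : path (far m) a l -> (0 < a)%N -> (last a l <= n)%N ->
  (forall i, i \in I -> (a <= i.+1)%N -> i.+1 \in a :: l) ->
  (forall k, k \in a :: l -> exists2 i, i \in I & k = i.+1) ->
  (forall y, y \in cov -> ((tag y).+1 < a)%N) ->
  legal_from H cov (flatten [seq blk k | k <- SPlist m (a :: l)]).
Proof.
elim: l a cov => [|b l IH] a cov.
  move=> _ _ _ _ /(_ a (mem_head _ _))[i Hi ->] Hc /=.
  rewrite cats0 blockE Hi; apply: legal_block => u.
  by apply/negP => /Hc /=; lia.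
rewrite [path _ _ _]/= => /andP[Hab Hl] Ha Hn HI Hk Hc.
have Hbl := far_path_last Hl; have {Hn} Hn : (last b l <= n)%N by [].
rewrite [SPlist _ _]/= -/(SPlist m (b :: l)) map_cat flatten_cat legal_from_cat.
move: Hab; rewrite /far => Hab.
apply/andP; split; last first.
  apply: IH => //; first by lia.
  - move=> i Hi Hbi; have := HI i Hi; rewrite inE => /(_ _)/orP[|/eqP|//]; lia.
  - by move=> k Hkl; apply: Hk; rewrite inE Hkl orbT.
  - move=> y; rewrite in_setU => /orP[/Hc|]; first by lia.
    (* The run before [b] ends at label [b - m - 1], so it dominates nothing beyond label
       [b - 1]. *)
    move/(@dominated_blocks _ (b - m - 1)); rewrite (_ : all _ _ = true); last first.
      by apply/allP => k; rewrite mem_iota; lia.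
    by move/(_ isT); lia.
have [i Hi Ei] := Hk a (mem_head _ _).
have -> : (b - m - a = (b - m - a).-1.+1)%N by lia.
rewrite /= legal_from_cat {1 2}Ei blockE Hi legal_block /=; last first.
  by move=> u; apply/negP => /Hc /=; lia.
apply: legal_singles; [lia | lia | |].
  move=> j Hj; apply/negP => Hja.
  have : j.+1 \in [:: a, b & l] by apply: HI => //; lia.
  rewrite !inE => /or3P[/eqP|/eqP|/(allP (far_path_min Hl))]; rewrite /far; lia.
move=> y; rewrite in_setU => /orP[/Hc|Hy]; first by lia.
have : y \in dominated H (flatten [seq blk k | k <- [:: a]]).
  by rewrite /= cats0 Ei blockE Hi.
by move/(@dominated_blocks [:: a] a); rewrite /= Ha leqnn => /(_ isT); lia.
Qed.

Lemma legal_expand : I != set0 -> indep m I -> legal_from H set0 (expand_SP m I S c).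
Proof.
move=> /labels_cons[a [l E]]; rewrite labels_indep E => Hl.
have -> : expand_SP m I S c = flatten [seq blk k | k <- SPlist m (a :: l)].
  by rewrite -E.
have Hlast : last a l \in labels I by rewrite E mem_last.
have Ha : a \in labels I by rewrite E mem_head.
apply: legal_SPlist => //.
- by case/andP: (labels_le Ha).
- by case/andP: (labels_le Hlast).
- by move=> i Hi _; rewrite -E mem_labels.
- by move=> k; rewrite -E => /labelsP.
- by move=> y; rewrite inE.
Qed.

End Expand.

(** * Upper bound: any legal sequence is at most as long as some weight *)

Section UpperBound.
Variable s : seq {i : 'I_n & T i}.
Hypotheses (Hs0 : (0 < size s)%N) (Hs : legal_from H set0 s).

Lemma cnbh_near x y : y \in cnbh H x -> near m (tag x : nat)%:Z%R (tag y : nat)%:Z%R.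
Proof.
have [->|/in_cnbh_diff->] := eqVneq (tag x) (tag y); first by rewrite /near; lia.
by rewrite /padj /near; lia.
Qed.

Lemma near_cnbh x y : tag x != tag y ->
  near m (tag x : nat)%:Z%R (tag y : nat)%:Z%R -> y \in cnbh H x.
Proof. by move=> Hxy; rewrite (in_cnbh_diff Hxy) /padj Hxy /near; lia. Qed.

Lemma legal_join_le_weight :
  exists J : {set 'I_n}, [/\ J != set0, indep m J & (size s <= weight J)%N].
Proof.
have /fin_all_exists[u Hu] := fun t => legal_footprint t Hs.
pose v (t : 'I_(size s)) := tnth (in_tuple s) t.
pose w t := tag (v t); pose b (t : 'I_(size s)) : 'I_n := tag (u t).
have Hfp : footprinting m (fun t => (w t : nat)%:Z)%R (fun t => (b t : nat)%:Z)%R.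
  split=> [t|r t Hrt|t /freshP Hf].
  - by have [/cnbh_near] := Hu t.
  - move=> Hn; have [_ /(_ r Hrt) Hru _] := Hu t; congr Posz; congr nat_of_ord.
    by apply/eqP; apply: contraNT Hru => Hne'; apply: near_cnbh.
  - have [_ _ Hut] := Hu t; rewrite /b Hut // => r Hrt.
    by apply: contra (Hf r Hrt); exact: cnbh_near.
have [J [J0 Ji JI JF HF]] := footprint_packing Hs0 Hfp.
have Hwb (r t : 'I_(size s)) : (r < t)%N -> near m (w r : nat)%:Z%R (b t : nat)%:Z%R -> w r = b t.
  by case: Hfp => _ H2 _ Hrt /(H2 _ _ Hrt)[E]; apply: val_inj.
have Hself t : near m (w t : nat)%:Z%R (b t : nat)%:Z%R by case: Hfp.
pose P k := [set t | b t == k].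
have P_gamma k : (#|P k| <= gamma_gr (e k))%N.
  have /card_gt0P[z _] := Hne k.
  (* Reads a vertex of the join as one of [T k], with default [z] for other blocks. *)
  pose cst y : T k := tagged_as (Tagged T z) y.
  have cstE y : tag y = k -> Tagged T (cst y) = y.
    by rewrite /cst; case: y => i p /= E; case: k / E z @cst => z _; rewrite tagged_asE.
  (* A visit from outside block [k] is replaced by its footprint, which dominates itself. *)
  pose x t := if w t == k then cst (v t) else cst (u t).
  have : legal_from (e k) set0 [seq x t | t <- enum (P k)].
    apply: (@legal_from_map _ (e k) _ x (fun t => cst (u t))).
      apply/allP => t; rewrite mem_enum inE => /eqP Ht; rewrite in_set0 andbT /x.
      case: eqP => [Hw|_]; last exact: cnbh_refl.
      by rewrite -in_cnbh_same !cstE //; have [] := Hu t.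
    have srt : pairwise (fun i j : 'I_(size s) => i < j)%N (enum (P k)).
      rewrite /enum_mem -enumT pairwise_filter // -(pairwise_map val ltn).
      by rewrite val_enum_ord -sorted_pairwise ?iota_ltn_sorted //; exact: ltn_trans.
    apply: (@sub_in_pairwise _ (mem (P k)) _ _ _ _ _ srt); last first.
      by apply/allP => t; rewrite mem_enum.
    move=> t1 t2 P1 P2 Ht.
    have /eqP h1 : b t1 == k by move: P1; rewrite inE.
    have /eqP h2 : b t2 == k by move: P2; rewrite inE.
    (* From another block, the visit at [t1] would have dominated all of block [k], leaving no
       footprint there at [t2]. *)
    have Ew : w t1 = k by rewrite -h2; apply: Hwb => //; rewrite h2 -h1.
    rewrite /= /x Ew eqxx -in_cnbh_same !cstE //.
    by have [_ /(_ _ Ht)] := Hu t2.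
  by move/legal_size_le; rewrite size_map -cardE.
have P_le1 k : k \notin J -> (#|P k| <= 1)%N.
  move=> kJ.
  have no (t1 t2 : 'I_(size s)) : (t1 < t2)%N -> t1 \in P k -> t2 \in P k -> False.
    move=> Ht; rewrite !inE => /eqP h1 /eqP h2.
    have Ew : w t1 == k by apply/eqP; rewrite -h2; apply: Hwb => //; rewrite h2 -h1.
    (* The first visit to [k] is fresh: an earlier visit near [k] also precedes [t2], so it would
       have to be in [k] itself. This puts [k] in [J]. *)
    case: (@arg_minnP _ t1 (fun t => w t == k) (fun t => t : nat) Ew) => t /eqP Et Hmin.
    suff /JI : fresh m (fun t => (w t : nat)%:Z)%R t by rewrite Et (negPf kJ).
    apply/freshP => r Hr; apply/negP; rewrite Et -h2 => /Hwb.
    have Ht1 := Hmin t1 Ew.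
    move=> /(_ (ltn_trans Hr (leq_ltn_trans Ht1 Ht))); rewrite h2 => /eqP/Hmin.
    by rewrite leqNgt Hr.
  apply/card_le1_eqP => t1 t2 h1 h2; apply: val_inj.
  by case: (ltngtP t1 t2) => // Ht; [case: (no _ _ Ht h1 h2) | case: (no _ _ Ht h2 h1)].
exists J; split=> //.
pose F := [set b t | t : 'I_(size s)].
(* Positions of [s] are counted by the block of their footprint. *)
have -> : size s = (\sum_(k in F) #|P k|)%N.
  rewrite -[LHS]card_ord -sum1_card (partition_big_imset b) /=.
  by apply: eq_bigr => k _; rewrite -sum1_card; apply: eq_bigl => t; rewrite inE.
apply: (@leq_trans (\sum_(k in F) (1 + if k \in J then (gamma_gr (e k)).-1 else 0))%N).
  apply: leq_sum => k _; case: ifPn => [_|]; last by move/P_le1.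
  by have := P_gamma k; have := gamma_gr_gt0 (e k) (Hne k); lia.
rewrite big_split /= sum1_card addnC /weight leq_add //.
rewrite -big_mkcondr /= (eq_bigl (mem J)) // => k.
by rewrite /= andbC; case: (boolP (k \in J)) => //= /(subsetP JF).
Qed.

End UpperBound.

(** * The maximum weight and the sets attaining it *)

Hypotheses (Hm : (0 < m)%N) (Hmn : (m + 2 <= n)%N).

Lemma weight_le_gamma I : I != set0 -> indep m I -> (weight I <= gamma_gr H)%N.
Proof.
move=> I0 II; have /fin_all_exists[S HS] := fun i => grundy_exists (e i).
have /fin_all_exists[c _] : forall i, exists x : T i, true.
  by move=> i; have /card_gt0P[x _] := Hne i; exists x.
by rewrite -(size_expand c HS I0 II); apply: legal_size_le; exact: legal_expand.
Qed.

Lemma gamma_weight : exists2 J : {set 'I_n}, J != set0 /\ indep m J & gamma_gr H = weight J.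
Proof.
have [s [/and3P[_ Hs _] Es]] := grundy_exists H.
have s0 : (0 < size s)%N.
  have H0 : (0 < n)%N by lia.
  have /card_gt0P[x _] := Hne (Ordinal H0).
  by rewrite Es; apply: gamma_gr_gt0; apply/card_gt0P; exists (Tagged T x).
have [J [J0 JI HJ]] := legal_join_le_weight s0 Hs.
by exists J => //; apply/eqP; rewrite eqn_leq -{1}Es HJ weight_le_gamma.
Qed.

(** A new element costs [m] in [weightE], which a growth of max - min by more than [m] outweighs. *)
Lemma weight_setU1 I i : I != set0 -> indep m I -> i \notin I -> indep m (i |: I) ->
  (maxI I + m + minI (i |: I) < maxI (i |: I) + minI I)%N ->
  (weight I < weight (i |: I))%N.
Proof.
move=> I0 II Hi Ii Hlt.
have I'0 : i |: I != set0 by apply/set0Pn; exists i; rewrite setU11.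
have := weightE I0 II; have := weightE I'0 Ii.
rewrite big_setU1 // cardsU1 Hi mulnDl mul1n /=.
by move: (\sum_(_ in I) _)%N (#|I| * m)%N => p q; lia.
Qed.

Lemma optimal_tildeI I : I != set0 -> indep m I -> weight I = gamma_gr H -> tildeI m I.
Proof.
move=> I0 II E; have [i Hi Ei] := minI_mem I0; have [j Hj Ej] := maxI_mem I0.
have /indepP Ind := II.
have hi k : k \in I -> (k <= j)%N by move=> /maxI_ge; rewrite Ej.
have lo k : k \in I -> (i <= k)%N by move=> /minI_le; rewrite Ei.
have no k : k \notin I -> indep m (k |: I) ->
    (maxI I + m + minI (k |: I) < maxI (k |: I) + minI I)%N -> False.
  move=> kI Ik Hlt; have := weight_setU1 I0 II kI Ik Hlt.
  have I'0 : k |: I != set0 by apply/set0Pn; exists k; rewrite setU11.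
  by rewrite E ltnNge weight_le_gamma.
rewrite /tildeI I0 II /=; apply/andP; split; rewrite leqNgt; apply/negP => Hlt.
  (* As [minI I > m + 1], the subtraction is exact; adding this block widens the spread by
     [m + 1]. *)
  have Hk : (i - m.+1 < n)%N by have := ltn_ord i; lia.
  apply: (no (Ordinal Hk)).
  - by apply/negP => /lo /=; lia.
  - apply/indepP => k l; rewrite !in_setU1 => /predU1P[->|Hk1] /predU1P[->|Hl1] //=.
    + by lia.
    + by have := lo _ Hl1; lia.
    + by have := lo _ Hk1; lia.
    + exact: Ind.
  - move: (minI_le (setU11 (Ordinal Hk) I)) (maxI_ge (setU1r (Ordinal Hk) Hj)).
    by move: (minI (_ |: _)) (maxI (_ |: _)) => p q /=; lia.
have Hk : (j + m.+1 < n)%N by lia.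
apply: (no (Ordinal Hk)).
- by apply/negP => /hi /=; lia.
- apply/indepP => k l; rewrite !in_setU1 => /predU1P[->|Hk1] /predU1P[->|Hl1] //=.
  + by lia.
  + by have := hi _ Hl1; lia.
  + by have := hi _ Hk1; lia.
  + exact: Ind.
- move: (maxI_ge (setU11 (Ordinal Hk) I)) (minI_le (setU1r (Ordinal Hk) Hi)).
  by move: (minI (_ |: _)) (maxI (_ |: _)) => p q /=; lia.
Qed.

End Join.

(** * The formula and the explicit Grundy dominating sequence *)

Local Open Scope ring_scope.

Theorem theorem5 (n m : nat) (T : 'I_n -> finType) (e : forall i, rel (T i))
  (Hm : (0 < m)%N) (Hmn : (m + 2 <= n)%N)
  (Hne : forall i, (0 < #|T i|)%N)
  (Hsym : forall i, symmetric (e i)) (Hirr : forall i, irreflexive (e i)) :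
  (* first part: gamma_gr of the join equals max over \tilde{I} of valI, plus m+1 *)
  ((exists2 I : {set 'I_n}, tildeI m I &
      (gamma_gr (join_rel m e))%:Z = (valI m e I + (m.+1)%:Z)%R) /\
   (forall I : {set 'I_n}, tildeI m I ->
      (valI m e I + (m.+1)%:Z <= (gamma_gr (join_rel m e))%:Z)%R)) /\
  (* second part *)
  (forall (S : forall i, seq (T i)) (Istar : {set 'I_n}) (c : forall i, T i),
     (forall i, grundy_dom_seq (e i) (S i)) ->
     tildeI m Istar ->
     (forall I, tildeI m I -> (valI m e I <= valI m e Istar)%R) ->
     grundy_dom_seq (join_rel m e) (expand_SP m Istar S c)).
Proof.
have [J [J0 JI] HJ] := gamma_weight e Hne Hm Hmn.
have tJ : tildeI m J by exact: optimal_tildeI Hne Hm Hmn J J0 JI (esym HJ).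
have ub I : tildeI m I -> (weight m e I <= gamma_gr (join_rel m e))%N.
  by case/and4P => I0 II _ _; exact: weight_le_gamma.
have vE I : tildeI m I -> (valI m e I + (m.+1)%:Z = (weight m e I)%:Z)%R.
  by case/and4P => I0 II _ _; exact: valI_weight.
split; first split.
- by exists J => //; rewrite vE // HJ.
- by move=> I tI; rewrite vE //; have := ub I tI; lia.
move=> S Istar c HS tI Hmax; have /and4P[I0 II _ _] := tI.
apply: legal_max_grundy; first exact: legal_expand.
rewrite (size_expand Hne c HS I0 II); apply/eqP; rewrite eqn_leq ub //= HJ.
(* [J] attains gamma_gr and lies in the family, so a maximizer [Istar] has at least its weight. *)
by have := Hmax J tJ; have := vE J tJ; have := vE _ tI; lia.
Qed.
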